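(* Let $X$ be a real Hilbert space, let $m\ge 2$ be an integer, and let $T_1,\ldots,T_m\colon X\to X$ be firmly nonexpansive mappings. Suppose that each $T_i$ ($i\in\{1,\ldots,m\}$) is asymptotically regular. Then the composition $T_mT_{m-1}\cdots T_1$ is asymptotically regular as well.
   Context: Let $X$ be a real Hilbert space with inner product $\langle\cdot,\cdot\rangle$ and induced norm $\|\cdot\|$. A mapping $T\colon X\to X$ is firmly nonexpansive if $\|Tx-Ty\|^2\le\langle x-y,Tx-Ty\rangle$ for all $x,y\in X$. A mapping $S\colon X\to X$ is asymptotically regular if for every $x\in X$, $S^nx-S^{n+1}x\to 0$ strongly (in norm) as $n\to\infty$, where $S^n$ denotes the $n$-fold composition of $S$. *)

(* Defs.v *)
From HB Require Import structures.
From mathcomp Require Import all_boot all_order all_algebra.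
From mathcomp Require Import all_classical all_reals all_analysis.

Set Implicit Arguments.
Unset Strict Implicit.
Unset Printing Implicit Defensive.
Import Order.TTheory GRing.Theory Num.Theory.
Import numFieldNormedType.Exports.

Local Open Scope classical_set_scope.
Local Open Scope ring_scope.

(* A real Hilbert space is a [completeNormedModType R] over a [realType] [R]
   together with [dot : {dot X for idfun}] (a symmetric positive definite
   bilinear form, as the conjugation is the identity) inducing its norm. *)
Definition induces_norm (R : realType) (X : normedModType R)
    (dot : {dot X for idfun}) : Prop :=
  forall x : X, `|x| = Num.sqrt (dot x x).

Definition firmly_nonexpansive (R : realType) (X : normedModType R)
    (dot : {dot X for idfun}) (T : X -> X) : Prop :=
  forall x y : X, `|T x - T y| ^+ 2 <= dot (x - y) (T x - T y).

Definition asymptotically_regular (R : realType) (X : normedModType R)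
    (S : X -> X) : Prop :=
  forall x : X, iter n S x - iter n.+1 S x @[n --> \oo] --> (0 : X).

(* T_(m-1) \o ... \o T_1 \o T_0: the map of smallest index is applied first. *)
Definition ord_comp (X : Type) (m : nat) (T : 'I_m -> X -> X) : X -> X :=
  fun x => foldl (fun y i => T i y) x (enum 'I_m).

(* Main.v *)
(** A composition S of m firmly nonexpansive maps satisfies
    |(x - y) - (S x - S y)|^2 <= 2^m (|x - y|^2 - |S x - S y|^2); summing this
    along two orbits shows that S is asymptotically regular as soon as the
    displacements |z - S z| are arbitrarily small.  To find such points z, let
    0 < e <= 1 and let y_0 be the fixed point of the strict contraction obtained
    by replacing each T_i with T_i ((1 - e) .), so that the intermediate points
    form a cycle y_0, ..., y_m = y_0.  Compare this cycle with points p_i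
    almost fixed by T_i.  As in the Brezis-Haraux theorem, monotonicity together
    with the rectangularity of Id minus the cyclic shift bounds e (|y_(i+1)|^2 -
    |y_i|^2) + (e |y_i|)^2 by a quantity that is small for small e; summed
    over the cycle the first term cancels, hence all e |y_i| are small, and so
    is |y_0 - S y_0| <= sum_i e |y_i|. *)

Require Import Defs.
From HB Require Import structures.
From mathcomp Require Import all_boot all_order all_algebra.
From mathcomp Require Import all_classical all_reals all_analysis.
From mathcomp Require Import ring lra.
Set Implicit Arguments.
Unset Strict Implicit.
Unset Printing Implicit Defensive.
Import Order.TTheory GRing.Theory Num.Theory.
Import numFieldNormedType.Exports.

Local Open Scope ring_scope.

Lemma dot_sym (R : realType) (X : lmodType R) (dot : {dot X for idfun})
    (x y : X) : dot x y = dot y x.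
Proof. by rewrite hermC /= expr0 mul1r. Qed.

Lemma dot_sqr_norm (R : realType) (X : normedModType R)
    (dot : {dot X for idfun}) (hdot : induces_norm dot) (x : X) :
  dot x x = `|x| ^+ 2.
Proof.
rewrite hdot sqr_sqrtr //.
have [->|x0] := eqVneq x 0; first by rewrite linear0l.
exact/ltW/neq0_dnorm_gt0.
Qed.

Lemma sqr_normB (R : realType) (X : normedModType R)
    (dot : {dot X for idfun}) (hdot : induces_norm dot) (x y : X) :
  `|x - y| ^+ 2 = `|x| ^+ 2 - 2 * dot x y + `|y| ^+ 2.
Proof.
rewrite -!(dot_sqr_norm hdot) linearBl /= !linearBr /= (dot_sym dot y x).
ring.
Qed.

Lemma ler_dot2 (R : realType) (X : normedModType R)
    (dot : {dot X for idfun}) (hdot : induces_norm dot) (x y : X) :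
  2 * dot x y <= `|x| ^+ 2 + `|y| ^+ 2.
Proof. by have := sqr_ge0 `|x - y|; rewrite (sqr_normB hdot); lra. Qed.

Lemma sqr_normD_le (R : realType) (X : normedModType R) (x y : X) :
  `|x + y| ^+ 2 <= 2 * `|x| ^+ 2 + 2 * `|y| ^+ 2.
Proof.
have := ler_normD x y; have := normr_ge0 (x + y).
have := sqr_ge0 (`|x| - `|y|); nra.
Qed.

Lemma firmly_nonexpansive_displacement (R : realType) (X : normedModType R)
    (dot : {dot X for idfun}) (hdot : induces_norm dot) (T : X -> X)
    (hT : firmly_nonexpansive dot T) (x y : X) :
  `|(x - y) - (T x - T y)| ^+ 2 <= `|x - y| ^+ 2 - `|T x - T y| ^+ 2.
Proof. by have := hT x y; rewrite (sqr_normB hdot (x - y)); lra. Qed.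

Lemma firmly_nonexpansive_lipschitz (R : realType) (X : normedModType R)
    (dot : {dot X for idfun}) (hdot : induces_norm dot) (T : X -> X)
    (hT : firmly_nonexpansive dot T) (x y : X) :
  `|T x - T y| <= `|x - y|.
Proof.
rewrite -(@ler_pXn2r _ 2) ?nnegrE //.
have := firmly_nonexpansive_displacement hdot hT x y.
have := sqr_ge0 `|(x - y) - (T x - T y)|; lra.
Qed.

(** The difference of squares on the left telescopes along a cycle; the right side is small once [p]
    is nearly fixed and [e] is then chosen small depending on [T p]. *)
Lemma regularized_step (R : realType) (X : normedModType R)
    (dot : {dot X for idfun}) (hdot : induces_norm dot) (T : X -> X)
    (hT : firmly_nonexpansive dot T) (e : R) (e0 : 0 <= e) (e1 : e <= 1)
    (p u : X) :
  e * (`|T ((1 - e) *: u)| ^+ 2 - `|u| ^+ 2) + (e * `|u|) ^+ 2 <=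
  e * `|T p| ^+ 2 + `|p - T p| ^+ 2.
Proof.
set v := T _; set a := T p; set b := p - a.
have pE : p = a + b by rewrite addrC subrK.
have mono0 := hT ((1 - e) *: u) p; rewrite -/v -/a in mono0.
clearbody b v a.
have mono : `|v - a| ^+ 2 <= (1 - e) * dot u v - (1 - e) * dot u a
    - dot v a + `|a| ^+ 2 - dot b v + dot a b.
  apply: (le_trans mono0).
  rewrite pE.
  rewrite -(dot_sqr_norm hdot) le_eqVlt; apply/orP; left; apply/eqP.
  rewrite linearBl /= linearDl /= linearZl_LR /= !linearBr /=.
  rewrite (dot_sym dot v a) (dot_sym dot a b); ring.
(* Rectangularity: the square of |(u - v) + a|. *)
have rect : 0 <= `|u| ^+ 2 + `|v| ^+ 2 + `|a| ^+ 2
    - 2 * dot u v + 2 * dot u a - 2 * dot v a.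
  have := sqr_ge0 `|(u - v) - - a|.
  rewrite !(sqr_normB hdot) normrN linearNr /= linearBl /=; lra.
(* Young's inequality for [e *: a - b] and [e *: v] absorbs the cross terms in [v] that remain after
   [mono] and [rect]. *)
have eab : 2 * (e * (e * dot v a - dot b v)) <=
    (e * `|a|) ^+ 2 - 2 * (e * dot a b) + `|b| ^+ 2 + (e * `|v|) ^+ 2.
  have := ler_dot2 hdot (e *: a - b) (e *: v).
  rewrite (sqr_normB hdot) !normrZ (ger0_norm e0) linearZr_LR /= linearBl /=.
  by rewrite !linearZl_LR /= (dot_sym dot a v); lra.
move: mono; rewrite (sqr_normB hdot) !exprMn => mono.
have mono2 : `|v| ^+ 2 <= (1 - e) * (dot u v - dot u a) + dot v a
    - dot b v + dot a b by lra.
have rect2 := mulr_ge0 (mulr_ge0 e0 (_ : 0 <= 1 - e)) rect.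
have {}rect2 := rect2 ltac:(lra).
have mono3 := ler_wpM2l e0 mono2; rewrite !exprMn in eab.
(* The goal is twice [mono3] plus [rect2] plus [eab]. *)
lra.
Qed.

Lemma iteri_lipschitz (R : realType) (X : normedModType R)
    (F : nat -> X -> X) (q : R) (q0 : 0 <= q)
    (hF : forall i x y, `|F i x - F i y| <= q * `|x - y|) (n : nat) (x y : X) :
  `|iteri n F x - iteri n F y| <= q ^+ n * `|x - y|.
Proof.
elim: n => [|n IH]; first by rewrite expr0 mul1r.
rewrite !iteriS exprS -mulrA; apply: (le_trans (hF _ _ _)).
exact: ler_wpM2l.
Qed.

Lemma iteri_displacement (R : realType) (X : normedModType R)
    (dot : {dot X for idfun}) (hdot : induces_norm dot) (T : nat -> X -> X)
    (hT : forall i, firmly_nonexpansive dot (T i)) (n : nat) (x y : X) :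
  `|(x - y) - (iteri n T x - iteri n T y)| ^+ 2 <=
  2 ^+ n * (`|x - y| ^+ 2 - `|iteri n T x - iteri n T y| ^+ 2).
Proof.
elim: n => [|n IH]; first by rewrite /= !subrr normr0 expr0n /= mulr0.
rewrite !iteriS [2 ^+ n.+1]exprS.
have := firmly_nonexpansive_displacement hdot (hT n) (iteri n T x) (iteri n T y).
move: IH; set d := x - y; set dn := iteri n T x - _; set dS := T n _ - _ => IH hS.
have := sqr_normD_le (d - dn) (dn - dS); rewrite subrKA => hD.
have p1 : 1 <= 2 ^+ n :> R by apply: exprn_ege1; lra.
(* Raises the weight of the last gap from 1 to [2 ^+ n], so that the two gaps telescope; the extra
   factor 2 comes from [hD]. *)
have hb := mulr_ge0 (_ : 0 <= 2 ^+ n - 1) (le_trans (sqr_ge0 _) hS).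
have {}hb := hb ltac:(lra).
lra.
Qed.

(** Compare the orbit of [x] with that of an almost fixed point [z]: while [x] still moves by more
    than [eta], the squared distance between the orbits drops by a fixed amount, which cannot go on
    forever. *)
Lemma approx_fixed_asymptotically_regular (R : realType) (X : normedModType R)
    (S : X -> X) (C : R)
    (hS : forall x y, `|(x - y) - (S x - S y)| ^+ 2 <=
      C * (`|x - y| ^+ 2 - `|S x - S y| ^+ 2))
    (hfix : forall eta, 0 < eta -> exists z, `|z - S z| <= eta) :
  0 < C -> asymptotically_regular S.
Proof.
move=> C0 x.
have lip u v : `|S u - S v| <= `|u - v|.
  rewrite -(@ler_pXn2r _ 2) ?nnegrE // -subr_ge0 -(pmulr_rge0 _ C0).
  exact: le_trans (sqr_ge0 _) (hS u v).
apply/cvgrPdist_le => eta eta0.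
have [z hz] : exists z, `|z - S z| <= eta / 2 by apply: hfix; lra.
have hzn n : `|iter n S z - iter n.+1 S z| <= eta / 2.
  by elim: n => [//|n IH]; apply: le_trans IH; rewrite !iterS.
pose a n := `|iter n S x - iter n S z| ^+ 2.
have [N hN] : exists N, `|iter N S x - iter N.+1 S x| <= eta.
  apply: contrapT => hno.
  have decr n : C * (a 0%N - a n) >= n%:R * (eta / 2) ^+ 2.
    elim: n => [|n IH]; first by rewrite subrr mulr0 mul0r.
    have hSn := hS (iter n S x) (iter n S z).
    rewrite -!iterS -/(a n) -/(a n.+1) in hSn.
    have far : eta < `|iter n S x - iter n.+1 S x|.
      by rewrite ltNge; apply/negP => ?; apply: hno; exists n.
    have near_ : eta / 2 <=
        `|iter n S x - iter n S z - (iter n.+1 S x - iter n.+1 S z)|.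
      rewrite opprD addrACA -opprD.
      have := lerB_dist (iter n S x - iter n.+1 S x) (iter n S z - iter n.+1 S z).
      by have := hzn n; lra.
    have : (eta / 2) ^+ 2 <= C * (a n - a n.+1).
      by apply: le_trans hSn; apply: lerXn2r => //; rewrite nnegrE; lra.
    by rewrite -[n.+1%:R]natr1; lra.
  pose n := Num.truncn (C * a 0%N / (eta / 2) ^+ 2).
  have := truncnS_gt (C * a 0%N / (eta / 2) ^+ 2); rewrite -/n.
  rewrite ltr_pdivrMr ?exprn_gt0 ?divr_gt0 //.
  have := decr n.+1; have := mulr_ge0 (ltW C0) (sqr_ge0 `|iter n.+1 S x - iter n.+1 S z|).
  rewrite -/(a n.+1); lra.
exists N => // n /= Nn; rewrite sub0r normrN.
apply: le_trans hN; rewrite -(subnKC Nn).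
(* Displacements along an orbit are nonincreasing because [S] is nonexpansive, so one small
   displacement is enough. *)
elim: (n - N)%N => [|k IH]; first by rewrite addn0.
by rewrite addnS; apply: le_trans IH; rewrite !iterS.
Qed.

(** Banach's theorem applies: each factor is [(1 - e)]-Lipschitz, and having at least one factor
    makes the composite a strict contraction. *)
Lemma regularized_fixed_point (R : realType) (X : completeNormedModType R)
    (dot : {dot X for idfun}) (hdot : induces_norm dot) (T : nat -> X -> X)
    (hT : forall i, firmly_nonexpansive dot (T i)) (m : nat) (e : R) :
  0 < e -> e <= 1 ->
  exists x, x = iteri m.+1 (fun i y => T i ((1 - e) *: y)) x.
Proof.
move=> e0 e1.
have q0 : 0 <= 1 - e by lra.
pose F := iteri m.+1 (fun i y => T i ((1 - e) *: y)).
have lipF x y : `|F x - F y| <= (1 - e) ^+ m.+1 * `|x - y|.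
  apply: iteri_lipschitz => // i u v.
  apply: (le_trans (firmly_nonexpansive_lipschitz hdot (hT i) _ _)).
  by rewrite -scalerBr normrZ ger0_norm.
have ctrF : is_contraction (totalfun F : {fun [set: X] >-> [set: X]}).
  exists (NngNum (exprn_ge0 m.+1 q0)); split => /=.
    by rewrite exprn_ilt1 //; lra.
  by move=> [x y] _; apply: lipF.
have [] := banach_fixed_point ctrF closedT; first by exists 0.
by move=> x _ hx; exists x.
Qed.

(** Step [i] perturbs the argument by [e *: y i], and nonexpansive maps never amplify earlier
    errors. *)
Lemma iteri_regularization_error (R : realType) (X : normedModType R)
    (T : nat -> X -> X) (lip : forall i x y, `|T i x - T i y| <= `|x - y|)
    (e : R) (e0 : 0 <= e) (y : nat -> X)
    (hy : forall i, y i.+1 = T i ((1 - e) *: y i)) (n : nat) :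
  `|y n - iteri n T (y 0%N)| <= \sum_(0 <= i < n) e * `|y i|.
Proof.
elim: n => [|n IH]; first by rewrite big_geq // subrr normr0.
rewrite big_nat_recr //= hy; apply: (le_trans (lip _ _ _)).
rewrite scalerBl scale1r addrAC; apply: (le_trans (ler_normB _ _)).
by rewrite normrZ ger0_norm // lerD2r.
Qed.

Lemma iteri_approx_fixed (R : realType) (X : completeNormedModType R)
    (dot : {dot X for idfun}) (hdot : induces_norm dot) (T : nat -> X -> X)
    (hT : forall i, firmly_nonexpansive dot (T i))
    (hfix : forall i eta, 0 < eta -> exists p, `|p - T i p| <= eta)
    (m : nat) (eta : R) :
  0 < eta -> exists x, `|x - iteri m T x| <= eta.
Proof.
case: m => [|m] eta0; first by exists 0; rewrite subrr normr0 ltW.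
pose M : R := m.+1%:R.
have M1 : 1 <= M by rewrite ler1n.
have M10 : 0 <= M + 1 by lra.
(* Chosen so that [M] terms, each at most [(M + 1) * d], add up to [eta]. *)
pose d := eta / (M * (M + 1)).
have d0 : 0 < d by rewrite divr_gt0 // mulr_gt0 //; lra.
have dE : M * ((M + 1) * d) = eta.
  by rewrite mulrA mulrC divfK // mulf_neq0 //; apply: lt0r_neq0; lra.
clearbody d.
have [p hp] := choice (fun i => hfix i d d0).
pose A := \sum_(0 <= i < m.+1) `|T i (p i)| ^+ 2.
have A0 : 0 <= A by apply: sumr_ge0 => i _; apply: sqr_ge0.
(* The points [p], hence [A], are fixed before [e], so [e] may depend on [A]; this choice gives both
   [e <= 1] and [e * A <= d ^+ 2]. *)
pose e := d ^+ 2 / (A + 1 + d ^+ 2).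
have den0 : 0 < A + 1 + d ^+ 2 by have := sqr_ge0 d; lra.
have e0 : 0 < e by rewrite divr_gt0 // exprn_gt0.
have e1 : e <= 1 by rewrite ler_pdivrMr //; lra.
have eA : e * A <= d ^+ 2.
  rewrite mulrAC ler_pdivrMr // ler_wpM2l ?sqr_ge0 //.
  by have := sqr_ge0 d; lra.
clearbody e.
have [x hx] := regularized_fixed_point hdot hT m e0 e1.
pose y i := iteri i (fun i y => T i ((1 - e) *: y)) x.
have sum_le : \sum_(0 <= i < m.+1) (e * `|y i|) ^+ 2 <= (M + 1) * d ^+ 2.
  have /ler_sum_nat := fun i (_ : (0 <= i < m.+1)%N) =>
    regularized_step hdot (hT i) (ltW e0) e1 (p i) (y i).
  rewrite !big_split /= -!mulr_sumr.
  have -> : \sum_(0 <= i < m.+1)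
      (`|T i ((1 - e) *: y i)| ^+ 2 - `|y i| ^+ 2) = 0.
    rewrite (telescope_sumr (fun i => `|y i| ^+ 2)) //.
    by rewrite /y -hx subrr.
  rewrite mulr0 add0r -/A => /le_trans; apply.
  have : \sum_(0 <= i < m.+1) `|p i - T i (p i)| ^+ 2 <=
         \sum_(0 <= i < m.+1) d ^+ 2.
    by apply: ler_sum => i _; rewrite lerXn2r ?nnegrE // ltW.
  rewrite sumr_const_nat subn0 -mulr_natl -/M; lra.
have term_le i : (i < m.+1)%N -> e * `|y i| <= (M + 1) * d.
  move=> im.
  rewrite -(@ler_pXn2r _ 2) ?nnegrE ?mulr_ge0 ?(ltW e0) ?(ltW d0) ?M10 //.
  have : (e * `|y i|) ^+ 2 <= (M + 1) * d ^+ 2.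
    apply: le_trans sum_le; rewrite (bigD1_seq i) ?mem_index_iota ?iota_uniq //=.
    by rewrite lerDl sumr_ge0 // => j _; apply: sqr_ge0.
  (* Since [M + 1 >= 1], bounding [M + 1] by its square avoids a square root. *)
  move=> /le_trans; apply; rewrite exprMn ler_wpM2r ?sqr_ge0 //.
  by rewrite expr2; nra.
have yS : forall i, y i.+1 = T i ((1 - e) *: y i) by [].
exists x; rewrite {1}hx.
have lip := fun i => firmly_nonexpansive_lipschitz hdot (hT i).
apply: (le_trans (iteri_regularization_error lip (ltW e0) yS m.+1)).
apply: (@le_trans _ _ (\sum_(0 <= i < m.+1) (M + 1) * d)).
  by apply: ler_sum_nat => i /andP[_ im]; apply: term_le.
by rewrite sumr_const_nat subn0 -mulr_natl -/M dE.
Qed.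

(** Indexing by [nat] permits induction on the number of maps. Out of range, [inord] defaults to
    [ord0], so every [T (inord i)] is still one of the given maps. *)
Lemma ord_comp_iteri (X : Type) (m : nat) (T : 'I_m.+1 -> X -> X) :
  ord_comp T = iteri m.+1 (fun i => T (inord i)).
Proof.
apply/funext => x; rewrite /ord_comp.
have -> : enum 'I_m.+1 = [seq inord i | i <- iota 0 m.+1].
  rewrite -val_enum_ord -map_comp map_id_in // => i _ /=.
  exact: inord_val.
suff H n : foldl (fun y i => T i y) x [seq inord i | i <- iota 0 n] =
    iteri n (fun i => T (inord i)) x by exact: H.
elim: n => [//|n IH].
by rewrite -[in iota _ _]addn1 iotaD map_cat foldl_cat /= IH add0n.
Qed.

Theorem theorem4p6 (R : realType) (X : completeNormedModType R)
    (dot : {dot X for idfun}) (hdot : induces_norm dot)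
    (m : nat) (hm : (2 <= m)%N) (T : 'I_m -> X -> X)
    (hT : forall i : 'I_m, firmly_nonexpansive dot (T i))
    (hreg : forall i : 'I_m, asymptotically_regular (T i)) :
  asymptotically_regular (ord_comp T).
Proof.
case: m hm T hT hreg => [//|m] _ T hT hreg.
rewrite ord_comp_iteri.
apply: (@approx_fixed_asymptotically_regular _ _ _ (2 ^+ m.+1)).
- by move=> x y; apply: iteri_displacement.
- apply: iteri_approx_fixed => // i eta eta0.
  (* Almost fixed points of each map are found far along its orbit of 0. *)
  have /cvgrPdist_le/(_ _ eta0) [N _ hN] := hreg (inord i) 0.
  exists (iter N (T (inord i)) 0).
  by have := hN N (leqnn N); rewrite sub0r normrN.
- by rewrite exprn_gt0.
Qed.
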